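(* Let $h$ be a fixed positive integer, and let $\{k_n\}_{n=1}^{\infty}$ be a sequence of positive integers such that $$k_n = o\left(n^{1/(2h)}\right).$$ Then $$\lim_{n\rightarrow\infty} \frac{B_h(k_n,n)}{\binom{n}{k_n}} = 1.$$
   Context: For a nonempty set $A$ of positive integers, a positive integer $h$ and an integer $m$, let $r_{A,h}(m)$ denote the number of $h$-tuples $(a_1,\ldots,a_h)$ of elements of $A$ with $a_1\leq\cdots\leq a_h$ and $a_1+\cdots+a_h=m$. $A$ is called a $B_h$-set if $r_{A,h}(m)\leq 1$ for every integer $m$ (that is, every element of the $h$-fold sumset $hA$ has exactly one such representation). For positive integers $h,k,n$, $B_h(k,n)$ denotes the number of $B_h$-sets $A\subseteq\{1,\ldots,n\}$ with $|A|=k$. For sequences $u_n$ and $v_n>0$, $u_n=o(v_n)$ means $\lim_{n\to\infty}u_n/v_n=0$. The quotient in the limit is defined for all sufficiently large $n$, since the hypothesis forces $k_n\leq n$ eventually. *)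

(* Defs.v *)
From HB Require Import structures.
From mathcomp Require Import all_boot all_order all_algebra.
From mathcomp Require Import all_classical all_reals all_analysis.

Set Implicit Arguments.
Unset Strict Implicit.
Unset Printing Implicit Defensive.

Import Order.TTheory GRing.Theory Num.Theory.
Import numFieldNormedType.Exports.

(* r_{A,h}(m). The summands are natural numbers adding up to m, so each is at
   most |m|: ranging over tuples of ordinals below |m| + 1 loses no
   representation, even for an infinite A. *)
Definition rep_count (A : {pred nat}) (h : nat) (m : int) : nat :=
  #|[set t : h.-tuple 'I_(absz m).+1 |
      [&& [forall i, (tnth t i : nat) \in A],
          sorted leq (map val t)
        & Posz (\sum_(i < h) tnth t i) == m]]%SET|.

Definition is_Bh_set (h : nat) (A : {pred nat}) : Prop :=
  [/\ exists a, a \in A,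
      forall a, a \in A -> 0 < a
    & forall m : int, rep_count A h m <= 1].

(* B_h(k,n). Subsets of {1, ..., n} are the S : {set 'I_n.+1} avoiding 0. *)
Definition Bh_number (h k n : nat) : nat :=
  #|[set S : {set 'I_n.+1} |
      [&& S \subset [set i : 'I_n.+1 | 0 < i]%SET,
          #|S| == k
        & `[< is_Bh_set h [pred a | a \in [seq val i | i in S]] >]]]%SET|.

(* Main.v *)
Require Import Defs.
From mathcomp Require Import all_boot all_order all_algebra.
From mathcomp Require Import all_classical all_reals all_analysis.
From mathcomp Require Import zify.
Import Order.TTheory GRing.Theory Num.Theory.
Import numFieldNormedType.Exports.

(** A random k-subset of {1, ..., n} is a B_h-set with probability at least
    1 - k^(2h) / (n - k + 1), by a union bound over coincidences of sums.

    Enumerate the subset by an injection f from {0, ..., k-1}.  If the subset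
    is not a B_h-set, two distinct multisets of h elements have the same sum;
    read through f, they are index maps i and j from {0, ..., h-1} to
    {0, ..., k-1} whose value multisets differ and for which
    sum_a f (i a) = sum_a f (j a) ([enumeration_collision]).  There are at most
    k^(2h) pairs (i, j).  For a fixed pair, some index x occurs a different
    number of times in i and in j, so the equation has a nonzero coefficient at
    f x and determines f x from the other values of f.  Hence the pair accounts
    for at most n (n-1) ... (n-k+2) injections ([card_inj_equal_sums]), out of
    n (n-1) ... (n-k+1) in all.  Each k-subset has exactly k! enumerations, so
    the same proportion bounds the k-subsets that are not B_h-sets
    ([card_not_Bh_sets]).

    Counting enumerations rather than subsets matters: deleting an element
    from a subset and recording its rank would cost an additional factor k,
    because C(n, k-1) / C(n, k) = k / (n - k + 1).

    Finally k = o(n^(1/(2h))) says k^(2h) / n tends to 0.  As k <= k^(2h), this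
    gives k <= n/2 eventually, so that n - k + 1 >= n/2 and the proportion of
    B_h-sets lies between 1 - 2 k^(2h) / n and 1 ([Bh_ratio_bounds]). *)

Definition fiber_card {I T : finType} (i : I -> T) (y : T) : nat :=
  #|[pred a | i a == y]|.

Lemma perm_codom_fibers {I T : finType} (i j : I -> T) :
  ~~ perm_eq (codom i) (codom j) -> exists x, fiber_card i x != fiber_card j x.
Proof.
have countE (l : I -> T) x : fiber_card l x = count_mem x (codom l).
  by rewrite /fiber_card cardE /enum_mem size_filter count_map enumT.
by case/allPn => x _ /=; rewrite -!countE; exists x.
Qed.

Lemma sum_comp_fibers {I T : finType} (i : I -> T) (g : T -> nat) :
  \sum_a g (i a) = \sum_y fiber_card i y * g y.
Proof.
rewrite (partition_big i predT) //=; apply: eq_bigr => y _.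
rewrite -sum_nat_const; by apply: eq_bigr => a /eqP ->.
Qed.

(** The equation between the two sums is linear in the values of the function,
    with coefficient [fiber_card i x - fiber_card j x] at [x]; this coefficient
    is nonzero, so the value at [x] can be solved for. *)
Lemma equal_sums_determine {I T : finType} {i j : I -> T} {x : T}
    {f g : T -> nat} :
    fiber_card i x != fiber_card j x -> (forall y, y != x -> f y = g y) ->
    \sum_a f (i a) = \sum_a f (j a) -> \sum_a g (i a) = \sum_a g (j a) ->
  f x = g x.
Proof.
move=> neq_ij eq_fg; rewrite !sum_comp_fibers.
have split_x c (e : T -> nat) :
    \sum_y c y * e y = c x * e x + \sum_(y | y != x) c y * e y.
  by rewrite (bigD1 x).
rewrite !split_x.
have tail c : \sum_(y | y != x) c y * g y = \sum_(y | y != x) c y * f y.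
  by apply: eq_bigr => y /eq_fg ->.
rewrite !tail; move: (\sum_(y | _) _) (\sum_(y | _) _) => s t; nia.
Qed.

(** By [equal_sums_determine], forgetting the value at [x] loses no
    information, and what remains is an injection of k indices into [P]. *)
Lemma card_inj_equal_sums {I : finType} {k N : nat} (P : {set 'I_N})
    {i j : I -> 'I_k.+1} {x : 'I_k.+1} :
    fiber_card i x != fiber_card j x ->
  #|[set f : {ffun 'I_k.+1 -> 'I_N} | [&& f \in ffun_on P, injectiveb f
       & \sum_a (f (i a) : nat) == \sum_a (f (j a) : nat)]]| <= #|P| ^_ k.
Proof.
move=> neq_ij; set E := [set f | _].
pose del (f : {ffun 'I_k.+1 -> 'I_N}) := [ffun y : 'I_k => f (lift x y)].
have del_inj : {in E &, injective del}.
  move=> f g; rewrite !inE => /and3P[_ _ /eqP fij] /and3P[_ _ /eqP gij].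
  move=> /ffunP eq_fg.
  have off y : y != x -> f y = g y.
    case: (unliftP x y) => [z -> _|-> /eqP //].
    by have := eq_fg z; rewrite !ffunE.
  apply/ffunP => y; have [->|/off//] := eqVneq y x; apply: val_inj.
  pose val_of (e : {ffun 'I_k.+1 -> 'I_N}) z : nat := e z.
  apply: (@equal_sums_determine _ _ i j x (val_of f) (val_of g)) => // z.
  by rewrite /val_of => /off ->.
rewrite -(card_in_imset del_inj) -[X in _ ^_ X]card_ord -card_inj_ffuns_on.
apply/subset_leq_card/fintype.subsetP => _ /imsetP[f + ->].
rewrite !inE => /and3P[/ffun_onP fP /injectiveP f_inj _]; apply/andP; split.
  by apply/ffun_onP => y; rewrite ffunE.
by apply/injectiveP => y z; rewrite !ffunE => /f_inj /lift_inj.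
Qed.

(** Sorted tuples are determined by their multiset of entries, so two
    different representations of the same integer are not permutations of each
    other.  In this form a collision survives reindexing of the summands. *)
Lemma not_Bh_setP (h : nat) (A : {pred nat}) :
    (exists a, a \in A) -> (forall a, a \in A -> 0 < a) ->
    ~ is_Bh_set h A ->
  exists t u : 'I_h -> nat, [/\ forall a, t a \in A, forall a, u a \in A,
    \sum_a t a = \sum_a u a & ~~ perm_eq (codom t) (codom u)].
Proof.
move=> A_nonempty A_pos; apply: contra_notP => no_collision; split=> // m.
rewrite leqNgt; apply/negP => /card_gt1P[t [u []]].
rewrite !inE => /and3P[/forallP tA t_sorted /eqP t_sum].
move=> /and3P[/forallP uA u_sorted /eqP u_sum] /eqP; apply.
have codomE (w : h.-tuple 'I_(absz m).+1) :
  codom (fun a => tnth w a : nat) = map val w.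
  by rewrite -[in RHS](map_tnth_enum w) -map_comp.
apply/val_inj/(inj_map val_inj).
apply: (sorted_eq leq_trans anti_leq) => //.
apply/idPn => not_perm; apply: no_collision.
exists (fun a => tnth t a : nat), (fun a => tnth u a : nat).
by split; rewrite ?codomE //; apply/eqP; rewrite -eqz_nat t_sum u_sum.
Qed.

Lemma leq_card_bigcup {T U : finType} (P : pred U) (F : U -> {set T}) :
  #|\bigcup_(p | P p) F p| <= \sum_(p | P p) #|F p|.
Proof.
elim/big_rec2: _ => [|p m A _ le_Am]; first by rewrite cards0.
by apply: leq_trans (leq_card_setU _ _) _; rewrite leq_add2l.
Qed.

Definition not_Bh_sets (h k n : nat) : {set {set 'I_n.+1}} :=
  [set S : {set 'I_n.+1} | [&& S \subset [set i : 'I_n.+1 | 0 < i], #|S| == k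
    & ~~ `[< is_Bh_set h [pred a | a \in [seq val i | i in S]] >]]].

Lemma card_positive_ord (n : nat) : #|[set i : 'I_n.+1 | 0 < i]| = n.
Proof.
have -> : [set i : 'I_n.+1 | 0 < i] = [set~ ord0].
  by apply/setP => i; rewrite !inE lt0n.
by rewrite cardsC1 card_ord.
Qed.

Lemma Bh_numberE (h k n : nat) :
  Bh_number h k n + #|not_Bh_sets h k n| = 'C(n, k).
Proof.
rewrite -[X in 'C(X, _)]card_positive_ord -cards_draws.
rewrite -[RHS](cardsID [set S : {set 'I_n.+1} |
  `[< is_Bh_set h [pred a | a \in [seq val i | i in S]] >]]).
rewrite /Bh_number; congr addn; apply: eq_card => S; rewrite !inE ?andbA //.
by rewrite andbC andbA.
Qed.

(** The pair (i, j) ranges over a set that depends only on [h] and [k], not on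
    the subset: this is what makes a union bound possible. *)
Lemma enumeration_collision {h k n : nat} {S : {set 'I_n.+1}}
    {f : {ffun 'I_k.+1 -> 'I_n.+1}} :
    S \in not_Bh_sets h k.+1 n -> [set f x | x in [set: 'I_k.+1]] = S ->
  exists i j : {ffun 'I_h -> 'I_k.+1}, ~~ perm_eq (codom i) (codom j) /\
    \sum_a (f (i a) : nat) = \sum_a (f (j a) : nat).
Proof.
rewrite inE => /and3P[/fintype.subsetP S_pos /eqP card_S /asboolPn not_Bh] im_f.
have S_memP a : a \in [seq val i | i in S] -> exists x, a = f x.
  case/fintype.imageP => s + ->; rewrite -im_f => /imsetP[x _ ->].
  by exists x.
have [||t [u [tS uS eq_sum not_perm]]] := not_Bh_setP _ _ _ _ not_Bh.
- have : f ord0 \in S by rewrite -im_f imset_f.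
  by move=> f0S; exists (f ord0 : nat); apply: fintype.image_f.
- by move=> a /fintype.imageP[s /S_pos + ->]; rewrite inE.
have choose_index (w : 'I_h -> nat) :
    (forall a, w a \in [seq val i | i in S]) ->
    exists i : {ffun 'I_h -> 'I_k.+1}, forall a, w a = f (i a).
  move=> wS; have [i iP] := choice (fun a => S_memP _ (wS a)).
  by exists [ffun a => i a] => a; rewrite ffunE.
have [i iP] := choose_index t tS; have [j jP] := choose_index u uS.
exists i, j; split.
  apply: contra not_perm => /(perm_map (fun x => f x : nat)).
  by rewrite /codom /image_mem -!map_comp !(eq_map iP, eq_map jP).
by rewrite -(eq_bigr _ (fun a _ => iP a)) -(eq_bigr _ (fun a _ => jP a)).
Qed.

(** The enumerations of the subsets that are not B_h-sets are counted twice: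
    each subset has (k+1)! of them, and each enumeration has a collision at one
    of the at most (k+1)^(2h) pairs of index maps, where [card_inj_equal_sums]
    applies. *)
Lemma card_not_Bh_enumerations (h k n : nat) :
  #|not_Bh_sets h k.+1 n| * k.+1`! <= k.+1 ^ (2 * h) * n ^_ k.
Proof.
set pos := [set i : 'I_n.+1 | 0 < i].
pose im (f : {ffun 'I_k.+1 -> 'I_n.+1}) := [set f x | x in [set: 'I_k.+1]].
pose X := [set f : {ffun 'I_k.+1 -> 'I_n.+1} |
  [&& f \in ffun_on pos, injectiveb f & im f \in not_Bh_sets h k.+1 n]].
pose E (p : {ffun 'I_h -> 'I_k.+1} * {ffun 'I_h -> 'I_k.+1}) :=
  [set f : {ffun 'I_k.+1 -> 'I_n.+1} | [&& f \in ffun_on pos, injectiveb f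
     & \sum_a (f (p.1 a) : nat) == \sum_a (f (p.2 a) : nat)]].
pose D (p : {ffun 'I_h -> 'I_k.+1} * {ffun 'I_h -> 'I_k.+1}) :=
  ~~ perm_eq (codom p.1) (codom p.2).
apply: (@leq_trans #|X|).
  (* Group the enumerations by their image: each fiber has at least (k+1)!
     elements. *)
  rewrite -[#|X|]sum1_card (partition_big im (mem (not_Bh_sets h k.+1 n))) /=.
    rewrite -sum_nat_const; apply: leq_sum => S S_bad; rewrite sum1dep_card.
    move: (S_bad); rewrite inE => /and3P[S_pos /eqP card_S _].
    rewrite -ffactnn -[X in _ ^_ X]card_ord -[X in X ^_ _]card_S.
    rewrite -card_inj_ffuns_on.
    apply/subset_leq_card/fintype.subsetP => f; rewrite !inE.
    case/andP=> /ffun_onP fS f_inj.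
    have im_f : im f = S.
      apply/eqP; rewrite eqEcard card_S card_imset ?cardsT ?card_ord ?leqnn //=.
        by rewrite andbT; apply/fintype.subsetP => _ /imsetP[x _ ->].
      exact/injectiveP.
    rewrite im_f eqxx f_inj; move: S_bad; rewrite inE => ->; rewrite !andbT.
    apply/ffun_onP => x.
    exact: (fintype.subsetP S_pos).
  by move=> f; rewrite inE => /and3P[].
apply: (@leq_trans #|\bigcup_(p | D p) E p|).
  apply/subset_leq_card/fintype.subsetP => f; rewrite inE.
  case/and3P=> fP f_inj f_bad.
  have [i [j [not_perm eq_sum]]] := enumeration_collision f_bad erefl.
  by apply/bigcupP; exists (i, j); rewrite // inE fP f_inj eq_sum /=.
apply: leq_trans (leq_card_bigcup _ _) _.
apply: (@leq_trans (\sum_(p | D p) n ^_ k)).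
  apply: leq_sum => p /perm_codom_fibers[x neq_x].
  by rewrite -[X in X ^_ _]card_positive_ord; apply: card_inj_equal_sums neq_x.
rewrite sum_nat_const leq_mul2r; apply/orP; right.
apply: leq_trans (max_card _) _.
by rewrite card_prod card_ffun !card_ord mul2n -addnn expnD.
Qed.

Lemma card_not_Bh_sets (h k n : nat) : 0 < k ->
  (n - k.-1) * #|not_Bh_sets h k n| <= k ^ (2 * h) * 'C(n, k).
Proof.
case: k => // k _ /=; rewrite -(leq_pmul2r (fact_gt0 k.+1)) -!mulnA bin_ffact.
by rewrite ffactnSr [leqRHS]mulnA [leqRHS]mulnC leq_mul2l
  card_not_Bh_enumerations orbT.
Qed.

Local Open Scope classical_set_scope.
Local Open Scope ring_scope.

(** The hypothesis [2 * k ^ (2 * h) <= n] forces [2 * k <= n], so that the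
    factor [n - k.-1] of [card_not_Bh_sets] is at least [n / 2]. *)
Lemma Bh_ratio_bounds (R : realFieldType) (h k n : nat) :
    (0 < h)%N -> (0 < k)%N -> (2 * k ^ (2 * h) <= n)%N ->
  1 - 2 * (k%:R ^+ (2 * h) / n%:R) <=
    ((Bh_number h k n)%:R / 'C(n, k)%:R : R) <= 1.
Proof.
move=> h_gt0 k_gt0 kh_le_n.
have k_le_kh : (k <= k ^ (2 * h))%N.
  by rewrite -[leqLHS]expn1 leq_pexp2l // muln_gt0.
have C_gt0 : (0 < 'C(n, k))%N by rewrite bin_gt0; lia.
have n_gt0 : (0 < n)%N by lia.
have bad_le : (#|not_Bh_sets h k n| * n <= 2 * k ^ (2 * h) * 'C(n, k))%N.
  have := card_not_Bh_sets h k n k_gt0.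
  rewrite -(leq_pmul2l (isT : 0 < 2)%N) !mulnA; apply: leq_trans.
  by rewrite mulnC leq_mul2r; apply/orP; right; lia.
have CE := Bh_numberE h k n; apply/andP; split; last first.
  by rewrite ler_pdivrMr ?ltr0n // mul1r ler_nat -CE leq_addr.
rewrite lerBlDr -lerBlDl.
have -> : 1 - (Bh_number h k n)%:R / 'C(n, k)%:R
    = #|not_Bh_sets h k n|%:R / 'C(n, k)%:R :> R.
  rewrite -[X in X - _](divff (x := 'C(n, k)%:R)) ?pnatr_eq0 -?lt0n //.
  by rewrite -mulrBl -{1}CE natrD addrAC subrr add0r.
rewrite ler_pdivrMr ?ltr0n // mulrA mulrAC ler_pdivlMr ?ltr0n //.
by rewrite -natrX -!natrM ler_nat.
Qed.

Lemma powR_root_expn (R : realType) (m : nat) (x : R) : (0 < m)%N -> 0 <= x ->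
  (x `^ (1 / m%:R)) ^+ m = x.
Proof.
move=> m_gt0 x_ge0; rewrite -powR_mulrn ?powR_ge0 // -powRrM mul1r.
by rewrite mulVf ?powRr1 // pnatr_eq0 -lt0n.
Qed.

Theorem theorem6 (R : realType) (h : nat) (h_gt0 : (0 < h)%N)
    (k : nat -> nat) (k_gt0 : forall n : nat, (0 < n)%N -> (0 < k n)%N)
    (k_small : (fun n : nat => (k n)%:R / n%:R `^ (1 / (2 * h)%N%:R) : R)
                 @ \oo --> (0 : R)) :
  (fun n : nat => (Bh_number h (k n) n)%:R / 'C(n, k n)%:R : R)
    @ \oo --> (1 : R).
Proof.
have h2_gt0 : (0 < 2 * h)%N by rewrite muln_gt0.
have kh_small : ((k n)%:R ^+ (2 * h) / n%:R : R) @[n --> \oo] --> (0 : R).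
  have /(cvg_comp _ _ k_small) := @exprn_continuous R (2 * h) 0.
  rewrite expr0n gtn_eqF //; apply: cvg_trans; apply: near_eq_cvg.
  apply: nearW => n /=.
  by rewrite exprMn exprVn powR_root_expn // ler0n.
apply: (squeeze_cvgr (h := fun=> 1)
  (f := fun n => 1 - 2 * ((k n)%:R ^+ (2 * h) / n%:R))).
- near=> n; have n_gt0 : (0 < n)%N by near: n; exact: nbhs_infty_gt.
  apply: Bh_ratio_bounds; rewrite ?k_gt0 // -(ler_nat R) natrM natrX.
  rewrite -ler_pdivlMl ?ltr0n // -ler_pdivrMr ?ltr0n //.
  by near: n; apply: cvgr_le kh_small _ _; rewrite invr_gt0 ltr0n.
- rewrite -[X in _ --> X]subr0 -[X in _ - X](mulr0 2).
  by apply: cvgB; [exact: cvg_cst|apply: cvgMr; exact: kh_small].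
- exact: cvg_cst.
Unshelve. all: by end_near. Qed.
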